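(* Let $(M,g)$ be a space-time with Ricci tensor $Ric$ and scalar curvature $s$, and let $T=Ric-\tfrac12 s\,g$ be the energy-momentum tensor given by the Einstein equations. Then the Einstein equations belong to the class $\Omega_2$, i.e. $\nabla_kT_{ij}=\nabla_iT_{kj}$, if and only if the Weyl projective curvature tensor $P$ of $(M,g)$ is harmonic, i.e. $d^*P=0$.
   Context: A space-time $(M,g)$ is a smooth four-dimensional manifold $M$ with a metric $g$ of Lorentz signature $(-+++)$; $\nabla$ is its Levi-Civita connection. The curvature tensor is given by $R^k_{lij}X^l=\nabla_i\nabla_jX^k-\nabla_j\nabla_iX^k$, with $R_{klij}=g_{km}R^m_{lij}$; the Ricci tensor is $R_{ij}=R^k_{ikj}$ and the scalar curvature is $s=g^{ij}R_{ij}$. The Einstein equations are $R_{ij}-\tfrac12 s\,g_{ij}=T_{ij}$. The Einstein equations belong to the class $\Omega_2$ if $\nabla_kT_{ij}=\nabla_iT_{kj}$ everywhere on $M$. On an $n$-dimensional pseudo-Riemannian manifold the Weyl projective curvature tensor $P$ has components $P_{lijk}=R_{lijk}-\frac{1}{n-1}\left(g_{lj}R_{ik}-g_{lk}R_{ij}\right)$ (here $n=4$). Its codifferential is $(d^*P)_{ijk}=-g^{ml}\nabla_mP_{lijk}$, and $P$ is called harmonic if $d^*P=0$. *)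

(* Defs.v *)
From HB Require Import structures.
From mathcomp Require Import all_boot all_order all_algebra.
From mathcomp Require Import ring.
From mathcomp Require Import boolp classical_sets functions reals.
From mathcomp Require Import topology normedtype derive.

Set Implicit Arguments.
Unset Strict Implicit.
Unset Printing Implicit Defensive.

Import Order.TTheory GRing.Theory Num.Theory.
Import numFieldNormedType.Exports.

Local Open Scope classical_set_scope.
Local Open Scope ring_scope.

Definition partial (R : realType) (n : nat) (i : 'I_n) (f : 'rV[R]_n -> R) :
  'rV[R]_n -> R := fun x => 'D_(delta_mx 0 i) f x.

(* C^k on U; only used for U open, where the continuity and the derivatives of
   the total function f at the points of U depend on the values of f on U
   only. *)
Fixpoint Ck_on (R : realType) (n : nat) (k : nat) (U : set 'rV[R]_n)
    (f : 'rV[R]_n -> R) : Prop :=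
  (forall x, U x -> {for x, continuous f}) /\
  if k is k'.+1 then
    forall i : 'I_n, (forall x, U x -> derivable f x (delta_mx 0 i)) /\
                     Ck_on k' U (partial i f)
  else True.

Definition smooth_on (R : realType) (n : nat) (U : set 'rV[R]_n)
    (f : 'rV[R]_n -> R) : Prop := forall k, Ck_on k U f.

Record chart (R : realType) (n : nat) (M : topologicalType) := Chart {
  chart_dom : set M;
  chart_img : set 'rV[R]_n;
  chart_map : M -> 'rV[R]_n;
  chart_inv : 'rV[R]_n -> M;
  chart_dom_open : open chart_dom;
  chart_img_open : open chart_img;
  chart_map_fun : set_fun chart_dom chart_img chart_map;
  chart_inv_fun : set_fun chart_img chart_dom chart_inv;
  chart_mapK : {in chart_dom, cancel chart_map chart_inv};
  chart_invK : {in chart_img, cancel chart_inv chart_map};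
  chart_map_continuous : {within chart_dom, continuous chart_map};
  chart_inv_continuous : {within chart_img, continuous chart_inv} }.

Definition overlap (R : realType) (n : nat) (M : topologicalType)
    (c d : chart R n M) : set 'rV[R]_n :=
  chart_img c `&` chart_inv c @^-1` chart_dom d.

Definition transition (R : realType) (n : nat) (M : topologicalType)
    (c d : chart R n M) : 'rV[R]_n -> 'rV[R]_n :=
  chart_map d \o chart_inv c.

(* The atlas need not be maximal. *)
Record smoothManifold (R : realType) (n : nat) := SmoothManifold {
  manifold_space :> topologicalType;
  manifold_hausdorff : hausdorff_space manifold_space;
  manifold_second_countable : @second_countable manifold_space;
  manifold_index : Type;
  manifold_chart : manifold_index -> chart R n manifold_space;
  manifold_cover :
    \bigcup_(a in [set: manifold_index]) chart_dom (manifold_chart a) = setT;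
  manifold_transition_smooth : forall (a b : manifold_index) (k : 'I_n),
    smooth_on (overlap (manifold_chart a) (manifold_chart b))
      (fun x => transition (manifold_chart a) (manifold_chart b) x 0 k) }.

(* A metric is given by its component matrices (g_ij) in the charts of the
   atlas. The library's Jacobian acts on row vectors, ('J f x) i k being the
   derivative of the k-th component of f in the i-th coordinate, so the last
   field reads g_ij = (d y^k / d x^i) (d y^l / d x^j) g'_kl. *)
Record pseudoRiemannianMetric (R : realType) (n : nat)
    (M : smoothManifold R n) := PseudoRiemannianMetric {
  metric_mx : manifold_index M -> 'rV[R]_n -> 'M[R]_n;
  metric_smooth : forall (a : manifold_index M) (i j : 'I_n),
    smooth_on (chart_img (manifold_chart a)) (fun x => metric_mx a x i j);
  metric_sym : forall (a : manifold_index M) (x : 'rV[R]_n),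
    chart_img (manifold_chart a) x -> (metric_mx a x)^T = metric_mx a x;
  metric_nondegenerate : forall (a : manifold_index M) (x : 'rV[R]_n),
    chart_img (manifold_chart a) x -> metric_mx a x \in unitmx;
  metric_transform : forall (a b : manifold_index M) (x : 'rV[R]_n),
    overlap (manifold_chart a) (manifold_chart b) x ->
    let tau := transition (manifold_chart a) (manifold_chart b) in
    metric_mx a x = 'J tau x *m metric_mx b (tau x) *m ('J tau x)^T }.

(* Signature (- + ... +): every tangent space has a basis, the rows of B, in
   which the metric is diag(-1, 1, ..., 1). *)
Definition lorentzian (R : realType) (n : nat) (M : smoothManifold R n)
    (g : pseudoRiemannianMetric M) : Prop :=
  forall (a : manifold_index M) (x : 'rV[R]_n),
    chart_img (manifold_chart a) x ->
    exists2 B : 'M[R]_n, B \in unitmx &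
      B *m metric_mx g a x *m B^T =
      diag_mx (\row_(i < n) (if val i == 0%N then -1 else 1)).

(* Below, G gives the components of a metric in one coordinate chart, and a
   tensor field is the family of its components, functions of the coordinates.
   A covariant derivative takes the index of the derivation first. *)
Section LocalGeometry.
Context {R : realType} {n : nat} (G : 'rV[R]_n -> 'M[R]_n).

Definition metric (i j : 'I_n) (x : 'rV[R]_n) : R := G x i j.

Definition cometric (i j : 'I_n) (x : 'rV[R]_n) : R := invmx (G x) i j.

(* christoffel k i j is Gamma^k_ij, for the Levi-Civita connection. *)
Definition christoffel (k i j : 'I_n) (x : 'rV[R]_n) : R :=
  2^-1 * \sum_(l < n) cometric k l x *
    (partial i (metric j l) x + partial j (metric i l) x
     - partial l (metric i j) x).

(* nabla_i X^k *)
Definition nabla_vector (X : 'I_n -> 'rV[R]_n -> R) (i k : 'I_n)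
    (x : 'rV[R]_n) : R :=
  partial i (X k) x + \sum_(m < n) christoffel k i m x * X m x.

(* nabla_i A^k_j, with A^k_j written A k j *)
Definition nabla_11 (A : 'I_n -> 'I_n -> 'rV[R]_n -> R) (i k j : 'I_n)
    (x : 'rV[R]_n) : R :=
  partial i (A k j) x + \sum_(m < n) christoffel k i m x * A m j x
  - \sum_(m < n) christoffel m i j x * A k m x.

(* nabla_k A_ij *)
Definition nabla_02 (A : 'I_n -> 'I_n -> 'rV[R]_n -> R) (k i j : 'I_n)
    (x : 'rV[R]_n) : R :=
  partial k (A i j) x
  - \sum_(m < n) christoffel m k i x * A m j x
  - \sum_(m < n) christoffel m k j x * A i m x.

(* nabla_m A_lijk *)
Definition nabla_04 (A : 'I_n -> 'I_n -> 'I_n -> 'I_n -> 'rV[R]_n -> R)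
    (m l i j k : 'I_n) (x : 'rV[R]_n) : R :=
  partial m (A l i j k) x
  - \sum_(p < n) christoffel p m l x * A p i j k x
  - \sum_(p < n) christoffel p m i x * A l p j k x
  - \sum_(p < n) christoffel p m j x * A l i p k x
  - \sum_(p < n) christoffel p m k x * A l i j p x.

(* nabla_i nabla_j X^k *)
Definition nabla2_vector (X : 'I_n -> 'rV[R]_n -> R) (i j k : 'I_n)
    (x : 'rV[R]_n) : R :=
  nabla_11 (fun k' j' => nabla_vector X j' k') i k j x.

Definition coord_field (l k : 'I_n) (_ : 'rV[R]_n) : R := (k == l)%:R.

(* R^k_lij, obtained from R^k_lij X^l = nabla_i nabla_j X^k - nabla_j nabla_i X^k
   by taking for X the l-th coordinate field. *)
Definition riemann_up (k l i j : 'I_n) (x : 'rV[R]_n) : R :=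
  nabla2_vector (coord_field l) i j k x - nabla2_vector (coord_field l) j i k x.

(* R_klij *)
Definition riemann (k l i j : 'I_n) (x : 'rV[R]_n) : R :=
  \sum_(m < n) metric k m x * riemann_up m l i j x.

Definition ricci (i j : 'I_n) (x : 'rV[R]_n) : R :=
  \sum_(k < n) riemann_up k i k j x.

Definition scalar_curvature (x : 'rV[R]_n) : R :=
  \sum_(i < n) \sum_(j < n) cometric i j x * ricci i j x.

(* The energy-momentum tensor given by the Einstein equations. *)
Definition energy_momentum (i j : 'I_n) (x : 'rV[R]_n) : R :=
  ricci i j x - 2^-1 * scalar_curvature x * metric i j x.

(* P_lijk *)
Definition weyl_projective (l i j k : 'I_n) (x : 'rV[R]_n) : R :=
  riemann l i j k x
  - (n%:R - 1)^-1 * (metric l j x * ricci i k x - metric l k x * ricci i j x).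

(* (d^* A)_ijk = - g^ml nabla_m A_lijk *)
Definition codifferential (A : 'I_n -> 'I_n -> 'I_n -> 'I_n -> 'rV[R]_n -> R)
    (i j k : 'I_n) (x : 'rV[R]_n) : R :=
  - \sum_(m < n) \sum_(l < n) cometric m l x * nabla_04 A m l i j k x.

End LocalGeometry.

(* The two properties characterizing the Levi-Civita connection: no torsion,
   and a parallel metric. *)
Section LeviCivita.
Context {R : realType} {n : nat} (G : 'rV[R]_n -> 'M[R]_n) (x : 'rV[R]_n)
  (G_sym : \forall y \near x, (G y)^T = G y).

Let partial_metricC (k i j : 'I_n) :
  partial k (metric G i j) x = partial k (metric G j i) x.
Proof.
apply: near_eq_derive; apply: filterS G_sym => y Gy.
by rewrite /metric -[in LHS]Gy mxE.
Qed.

Lemma christoffelC (k i j : 'I_n) :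
  christoffel G k i j x = christoffel G k j i x.
Proof.
rewrite /christoffel; congr (_ * _); apply: eq_bigr => l _.
by rewrite (partial_metricC l i j) [partial i _ x + _]addrC.
Qed.

Lemma nabla_metric (k i j : 'I_n) : G x \in unitmx ->
  nabla_02 G (metric G) k i j x = 0.
Proof.
move=> Gu; have Gs : (G x)^T = G x by exact: nbhs_singleton G_sym.
have lower a b c : \sum_(m < n) christoffel G m a b x * metric G m c x =
    2^-1 * (partial a (metric G b c) x + partial b (metric G a c) x
            - partial c (metric G a b) x).
  rewrite /christoffel.
  under eq_bigr => m _ do rewrite -mulrA mulr_suml.
  rewrite -mulr_sumr exchange_big /=; congr (_ * _).
  transitivity (\sum_(l < n) (invmx (G x) *m G x) l c *
    (partial a (metric G b l) x + partial b (metric G a l) x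
     - partial l (metric G a b) x)).
    apply: eq_bigr => l _; rewrite mxE mulr_suml; apply: eq_bigr => m _.
    rewrite mulrAC /metric /cometric; congr (_ * _ * _).
    by rewrite -[in LHS]Gs -trmx_inv mxE.
  rewrite mulVmx // (bigD1 c) //= mxE eqxx mul1r big1 ?addr0 // => l lc.
  by rewrite mxE (negbTE lc) mul0r.
rewrite /nabla_02 lower.
under [X in _ - _ - X]eq_bigr => m _ do
  rewrite -[metric G i m x]/(G x i m) -Gs mxE -/(metric G m i x).
rewrite lower (partial_metricC k j i).
by field.
Qed.

End LeviCivita.

Definition einstein_Omega2 (R : realType) (n : nat) (M : smoothManifold R n)
    (g : pseudoRiemannianMetric M) : Prop :=
  forall (a : manifold_index M) (x : 'rV[R]_n),
    chart_img (manifold_chart a) x ->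
    forall i j k : 'I_n,
      nabla_02 (metric_mx g a) (energy_momentum (metric_mx g a)) k i j x =
      nabla_02 (metric_mx g a) (energy_momentum (metric_mx g a)) i k j x.

Definition harmonic_weyl_projective (R : realType) (n : nat)
    (M : smoothManifold R n) (g : pseudoRiemannianMetric M) : Prop :=
  forall (a : manifold_index M) (x : 'rV[R]_n),
    chart_img (manifold_chart a) x ->
    forall i j k : 'I_n,
      codifferential (metric_mx g a) (weyl_projective (metric_mx g a))
        i j k x = 0.

(* Main.v *)
Require Import Defs.
From HB Require Import structures.
From mathcomp Require Import all_boot all_order all_algebra.
From mathcomp Require Import ring lra.
From mathcomp Require Import boolp classical_sets functions reals.
From mathcomp Require Import topology normedtype derive.

(* Write Ric for the Ricci tensor and s for the scalar curvature. The second
   Bianchi identity gives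
     g^ml nabla_m R_lijk = nabla_j R_ik - nabla_k R_ij,
   and therefore
     (d^* P)_ijk = (1/(n-1) - 1) (nabla_j R_ik - nabla_k R_ij),
   so that, for n > 2, P is harmonic iff nabla Ric is totally symmetric. By the
   contracted Bianchi identity ds = 2 div Ric, both the total symmetry of
   nabla Ric and that of nabla T force ds = 0 after a contraction with the
   metric: the first one gives ds = ds / 2, the second one (n - 2) ds = 0. Once
   s is constant, nabla T = nabla Ric.

   The identities are proved in a chart, the components R^k_lij being gathered
   in the matrix R_ij = d_i Gamma_j - d_j Gamma_i + [Gamma_i, Gamma_j]. *)

Set Implicit Arguments.
Unset Strict Implicit.
Unset Printing Implicit Defensive.

Import Order.TTheory GRing.Theory Num.Theory.
Import numFieldNormedType.Exports.

Local Open Scope classical_set_scope.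
Local Open Scope ring_scope.

(** * Smooth functions and the symmetry of second derivatives *)

Section Smooth.
Context {R : realType} {n : nat} (U : set 'rV[R]_n) (oU : open U).
Implicit Types (f g : 'rV[R]_n -> R) (x : 'rV[R]_n) (i j : 'I_n) (k : nat).

Lemma near_open x : U x -> \forall y \near x, U y.
Proof. by move=> Ux; exact: open_nbhs_nbhs. Qed.

Lemma partial_ext i f g x : U x -> (forall y, U y -> f y = g y) ->
  partial i f x = partial i g x.
Proof.
by move=> Ux fg; apply: near_eq_derive; apply: filterS (near_open Ux).
Qed.

Lemma continuous_for_ext f g x : U x -> (forall y, U y -> f y = g y) ->
  {for x, continuous f} -> {for x, continuous g}.
Proof.
move=> Ux fg cf; have : f y @[y --> x] --> g x by rewrite -fg //; exact: cf.
apply: cvg_trans; apply: (@near_eq_cvg _ _ (nbhs x)).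
by near=> y; rewrite fg //; near: y; exact: near_open.
Unshelve. all: by end_near. Qed.

(** Since U is open, agreement on U is agreement near each of its points, so it passes to the
    partial derivatives. They again agree on U only, which is why the induction keeps f and g
    general. *)
Lemma Ck_on_ext k f g : (forall y, U y -> f y = g y) ->
  Ck_on k U f -> Ck_on k U g.
Proof.
elim: k f g => [|k IHk] f g fg /= [cf sf].
  by split=> // x Ux; exact: continuous_for_ext (cf x Ux).
split=> [x Ux|i]; first exact: continuous_for_ext (cf x Ux).
have [df sdf] := sf i; split=> [x Ux|].
  apply: near_eq_derivable (df x Ux); near=> y; apply: fg.
  by near: y; exact: near_open.
by apply: IHk sdf => y Uy; exact: partial_ext.
Unshelve. all: by end_near. Qed.

Lemma Ck_onW k f : Ck_on k.+1 U f -> Ck_on k U f.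
Proof.
elim: k f => [|k IHk] f /= [cf sf]; split=> // i.
by have [df sdf] := sf i; split => //; apply: IHk.
Qed.

Lemma Ck_on_cst k (c : R) : Ck_on k U (fun=> c).
Proof.
elim: k c => [|k IHk] c.
  by split=> // x _; exact: cst_continuous.
split=> [x _|i]; first exact: cst_continuous.
split=> [x _|]; first exact: derivable_cst.
by apply: Ck_on_ext (IHk 0) => y _; rewrite /partial derive_cst.
Qed.

Lemma Ck_onD k f g : Ck_on k U f -> Ck_on k U g ->
  Ck_on k U (fun x => f x + g x).
Proof.
elim: k f g => [|k IHk] f g /= [cf sf] [cg sg].
  by split=> // x Ux; apply: continuousD; [exact: cf|exact: cg].
split=> [x Ux|i]; first by apply: continuousD; [exact: cf|exact: cg].
have [df sdf] := sf i; have [dg sdg] := sg i; split.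
  by move=> x Ux; apply: derivableD; [exact: df|exact: dg].
apply: Ck_on_ext (IHk _ _ sdf sdg) => y Uy.
by rewrite /partial -deriveD //; [exact: df|exact: dg].
Qed.

Lemma Ck_onM k f g : Ck_on k U f -> Ck_on k U g ->
  Ck_on k U (fun x => f x * g x).
Proof.
elim: k f g => [|k IHk] f g sf0 sg0; case: (sf0) (sg0) => [cf sf] [cg sg].
  by split=> // x Ux; apply: continuousM; [exact: cf|exact: cg].
split=> [x Ux|i]; first by apply: continuousM; [exact: cf|exact: cg].
have [df sdf] := sf i; have [dg sdg] := sg i; split.
  by move=> x Ux; apply: derivableM; [exact: df|exact: dg].
(* The Leibniz rule mixes f and g with their derivatives, so f and g are first lowered to order
   k. *)
apply: Ck_on_ext (Ck_onD (IHk _ _ (Ck_onW sf0) sdg)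
                         (IHk _ _ (Ck_onW sg0) sdf)) => y Uy.
by rewrite /partial -[LHS]deriveM //; [exact: df|exact: dg].
Qed.

Lemma smooth_on_ext f g : (forall y, U y -> f y = g y) ->
  smooth_on U f -> smooth_on U g.
Proof. by move=> fg sf k; exact: Ck_on_ext (sf k). Qed.

Lemma smooth_on_cst (c : R) : smooth_on U (fun=> c).
Proof. by move=> k; exact: Ck_on_cst. Qed.

Lemma smooth_onD f g : smooth_on U f -> smooth_on U g ->
  smooth_on U (fun x => f x + g x).
Proof. by move=> sf sg k; exact: Ck_onD. Qed.

Lemma smooth_onM f g : smooth_on U f -> smooth_on U g ->
  smooth_on U (fun x => f x * g x).
Proof. by move=> sf sg k; exact: Ck_onM. Qed.

Lemma smooth_onN f : smooth_on U f -> smooth_on U (fun x => - f x).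
Proof.
move=> sf; apply: smooth_on_ext (smooth_onM (smooth_on_cst (-1)) sf) => y _.
by rewrite mulN1r.
Qed.

Lemma smooth_onB f g : smooth_on U f -> smooth_on U g ->
  smooth_on U (fun x => f x - g x).
Proof. by move=> sf sg; apply: smooth_onD => //; exact: smooth_onN. Qed.

Lemma smooth_on_sum (I : finType) (f : I -> 'rV[R]_n -> R) :
  (forall a, smooth_on U (f a)) -> smooth_on U (fun x => \sum_a f a x).
Proof.
move=> sf; elim: index_enum => [|a s IHs].
  by under eq_fun do rewrite big_nil; exact: smooth_on_cst.
by under eq_fun do rewrite big_cons; exact: smooth_onD.
Qed.

Lemma smooth_on_prod (I : finType) (f : I -> 'rV[R]_n -> R) :
  (forall a, smooth_on U (f a)) -> smooth_on U (fun x => \prod_a f a x).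
Proof.
move=> sf; elim: index_enum => [|a s IHs].
  by under eq_fun do rewrite big_nil; exact: smooth_on_cst.
by under eq_fun do rewrite big_cons; exact: smooth_onM.
Qed.

Lemma smooth_on_continuous f x : smooth_on U f -> U x -> {for x, continuous f}.
Proof. by move=> /(_ 0%N)[cf _]; exact: cf. Qed.

Lemma smooth_on_derivable i f x : smooth_on U f -> U x ->
  derivable f x (delta_mx 0 i).
Proof. by move=> /(_ 1%N)[_ /(_ i)[df _]]; exact: df. Qed.

Lemma smooth_on_partial i f : smooth_on U f -> smooth_on U (partial i f).
Proof. by move=> sf k; have [_ /(_ i)[]] := sf k.+1. Qed.

(** The derivatives of 1/f are - f' (1/f)^2: if 1/f is C^k, then so are they, and 1/f is C^(k+1). *)
Lemma smooth_onV f : (forall x, U x -> f x != 0) -> smooth_on U f ->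
  smooth_on U (fun x => (f x)^-1).
Proof.
move=> f0 sf.
have cfV x : U x -> {for x, continuous (fun y => (f y)^-1)}.
  by move=> Ux; apply: continuousV; [exact: f0|exact: smooth_on_continuous].
elim=> [|k IHk]; split=> // i; split.
  by move=> x Ux; apply: derivableV; [exact: f0|exact: smooth_on_derivable].
have := Ck_onM (smooth_onN (smooth_on_partial i sf) k) (Ck_onM IHk IHk).
apply: Ck_on_ext => y Uy; rewrite /partial deriveV; last 2 first.
- exact: f0.
- exact: smooth_on_derivable.
by rewrite -invfM -expr2 scaleNr mulNr mulrC.
Qed.

(** * Rules for partial derivatives *)

Lemma partialD i f g x : smooth_on U f -> smooth_on U g -> U x ->
  partial i (fun y => f y + g y) x = partial i f x + partial i g x.
Proof. by move=> sf sg Ux; apply: deriveD; exact: smooth_on_derivable. Qed.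

Lemma partialM i f g x : smooth_on U f -> smooth_on U g -> U x ->
  partial i (fun y => f y * g y) x = partial i f x * g x + f x * partial i g x.
Proof.
move=> sf sg Ux; rewrite [LHS]deriveM; last 2 first.
- exact: smooth_on_derivable.
- exact: smooth_on_derivable.
by rewrite addrC [in RHS]mulrC.
Qed.

Lemma partialN i f x : smooth_on U f -> U x ->
  partial i (fun y => - f y) x = - partial i f x.
Proof. by move=> sf Ux; apply: deriveN; exact: smooth_on_derivable. Qed.

Lemma partialB i f g x : smooth_on U f -> smooth_on U g -> U x ->
  partial i (fun y => f y - g y) x = partial i f x - partial i g x.
Proof. by move=> sf sg Ux; apply: deriveB; exact: smooth_on_derivable. Qed.

Lemma partial_cst i (c : R) x : partial i (fun=> c) x = 0.
Proof. exact: derive_cst. Qed.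

Lemma partial_sum (I : finType) i (f : I -> 'rV[R]_n -> R) x :
  (forall a, smooth_on U (f a)) -> U x ->
  partial i (fun y => \sum_a f a y) x = \sum_a partial i (f a) x.
Proof.
move=> sf Ux.
(* The induction on lists carries smoothness along, because [partialD] asks for it on the tail. *)
suff : forall s : seq I, smooth_on U (fun y => \sum_(a <- s) f a y) /\
    partial i (fun y => \sum_(a <- s) f a y) x =
      \sum_(a <- s) partial i (f a) x.
  by move=> /(_ (index_enum I)) [].
elim=> [|a s [sS dS]].
  under eq_fun do rewrite big_nil.
  by rewrite big_nil partial_cst; split => //; exact: smooth_on_cst.
under eq_fun do rewrite big_cons.
by rewrite big_cons partialD // dS; split => //; exact: smooth_onD.
Qed.

(** * Mean value theorem along lines and symmetry of second derivatives *)

(** No chain rule is involved, and derivability along v alone suffices: both difference quotients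
    are the same function of h. *)
Lemma is_derive_line f (x v : 'rV[R]_n) (t : R) :
  derivable f (x + t *: v) v ->
  is_derive t 1 (fun s => f (x + s *: v)) ('D_v f (x + t *: v)).
Proof.
have E : (fun h => h^-1 *: (((fun s => f (x + s *: v)) \o shift t) (h *: 1)
          - f (x + t *: v))) =
    (fun h => h^-1 *: ((f \o shift (x + t *: v)) (h *: v) - f (x + t *: v))).
  apply/funext => h /=; congr (_ *: (f _ - _)).
  by rewrite [h *: 1]mulr1 scalerDl addrCA addrA.
move=> df; apply: DeriveDef; first by rewrite /derivable E.
by rewrite /derive E.
Qed.

Lemma is_derive_translate f (x v w : 'rV[R]_n) : derivable f (x + w) v ->
  is_derive x v (fun y => f (y + w)) ('D_v f (x + w)).
Proof.
have E : (fun h => h^-1 *: (((fun y => f (y + w)) \o shift x) (h *: v)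
          - f (x + w))) =
    (fun h => h^-1 *: ((f \o shift (x + w)) (h *: v) - f (x + w))).
  by apply/funext => h /=; rewrite addrA.
move=> df; apply: DeriveDef; first by rewrite /derivable E.
by rewrite /derive E.
Qed.

Lemma MVT_line f (x v : 'rV[R]_n) (h : R) : 0 < h ->
  (forall s, 0 <= s <= h -> derivable f (x + s *: v) v) ->
  exists2 s, 0 <= s <= h & f (x + h *: v) - f x = 'D_v f (x + s *: v) * h.
Proof.
move=> h0 df.
have [||c] :=
  @MVT R (fun s => f (x + s *: v)) (fun s => 'D_v f (x + s *: v)) 0 h h0.
- move=> s; rewrite in_itv /= => /andP[s0 sh].
  by apply: is_derive_line; apply: df; rewrite !ltW.
- apply: derivable_within_continuous => s; rewrite in_itv /= => sh.
  by have [] := is_derive_line (df s sh).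
rewrite in_itv /= scale0r addr0 subr0 => /andP[c0 ch] E.
by exists c => //; rewrite !ltW.
Qed.

(* The mean value theorem is applied along u to y |-> f (y + h v) - f y, and
   then along v to the i-th derivative of f. *)
Lemma second_difference i j f x (e : R) : smooth_on U f -> U x -> 0 < e ->
  let u : 'rV[R]_n := delta_mx 0 i in let v : 'rV[R]_n := delta_mx 0 j in
  \forall h \near 0^'+,
    `|(f (x + h *: u + h *: v) - f (x + h *: v) - (f (x + h *: u) - f x))
       - partial j (partial i f) x * h ^+ 2| <= e * h ^+ 2.
Proof.
move=> sf Ux e0 u v.
have sif := smooth_on_partial i sf.
have cp := smooth_on_continuous (smooth_on_partial j sif) Ux.
have : \forall y \near x, U y /\
    `|partial j (partial i f) x - partial j (partial i f) y| <= e.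
  apply: filterI; first exact: near_open.
  by move/cvgrPdist_le : cp => /(_ e e0).
move=> /nbhs_ballP[r /= r0 Br].
(* For small h the whole parallelogram spanned by h u and h v at x stays in the ball, hence in U and
   where the second derivative is e-close to its value at x. *)
have near_x h s t : h * (`|u| + `|v|) < r -> 0 <= s <= h -> 0 <= t <= h ->
    ball x r (x + s *: u + t *: v).
  move=> hr /andP[s0 sh] /andP[t0 th].
  rewrite -ball_normE /ball_ /= -addrA opprD addrA subrr add0r normrN.
  apply: le_lt_trans hr; rewrite (le_trans (ler_normD _ _)) // mulrDr.
  by rewrite !normrZ !ger0_norm // lerD // ler_wpM2r.
(* The summand 1 gives a positive divisor without computing the norms of u and v. *)
have uv0 : 0 < `|u| + `|v| + 1 by rewrite ltr_wpDl // addr_ge0.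
near=> h.
have h0 : 0 < h by near: h; exact: nbhs_right_gt.
have hr : h * (`|u| + `|v|) < r.
  have : h < r / (`|u| + `|v| + 1).
    by near: h; apply: nbhs_right_lt; exact: divr_gt0.
  rewrite ltr_pdivlMr //; apply: le_lt_trans.
  by rewrite ler_wpM2l ?lerDl // ltW.
have hh : 0 <= h <= h by rewrite lexx ltW.
have zh : 0 <= (0 : R) <= h by rewrite lexx ltW.
pose phi y := f (y + h *: v) - f y.
have dphi s : 0 <= s <= h ->
    is_derive (x + s *: u) u phi
      (partial i f (x + s *: u + h *: v) - partial i f (x + s *: u)).
  move=> sh.
  have dv : is_derive (x + s *: u) u (fun y => f (y + h *: v))
      (partial i f (x + s *: u + h *: v)).
    apply: is_derive_translate; apply: smooth_on_derivable sf _.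
    by have [] := Br _ (near_x h s h hr sh hh).
  have Us : U (x + s *: u).
    by have [] := Br _ (near_x h s 0 hr sh zh); rewrite scale0r addr0.
  by apply: is_deriveB dv (derivableP _); exact: smooth_on_derivable.
have [s sh Es] : exists2 s, 0 <= s <= h &
    phi (x + h *: u) - phi x = 'D_u phi (x + s *: u) * h.
  apply: (@MVT_line phi x u h h0) => s sh.
  exact: @ex_derive _ _ _ _ _ _ _ (dphi s sh).
have [t th Et] : exists2 t, 0 <= t <= h &
    partial i f (x + s *: u + h *: v) - partial i f (x + s *: u) =
    partial j (partial i f) (x + s *: u + t *: v) * h.
  apply: (@MVT_line (partial i f) (x + s *: u) v h h0) => t th.
  apply: smooth_on_derivable sif _.
  by have [] := Br _ (near_x h s t hr sh th).
have {}Es : f (x + h *: u + h *: v) - f (x + h *: v) - (f (x + h *: u) - f x)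
    = partial j (partial i f) (x + s *: u + t *: v) * h ^+ 2.
  rewrite expr2 mulrA -Et -(@derive_val _ _ _ _ _ _ _ (dphi s sh)) -Es /phi.
  ring.
rewrite Es -mulrBl normrM [`|h ^+ 2|]ger0_norm ?sqr_ge0 //.
rewrite ler_wpM2r ?sqr_ge0 //.
by rewrite distrC; have [] := Br _ (near_x h s t hr sh th).
Unshelve. all: by end_near. Qed.

(** The second difference is symmetric in i and j, so for one common h > 0 both mixed derivatives
    times h^2 lie within (e/2) h^2 of the same number; dividing by h^2 leaves them at distance at
    most e. *)
Lemma partialC i j f x : smooth_on U f -> U x ->
  partial i (partial j f) x = partial j (partial i f) x.
Proof.
move=> sf Ux; apply/eqP; rewrite -subr_eq0 -normr_le0.
apply/ler_addgt0Pl => e e0; rewrite addr0.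
have e2 : 0 < e / 2 by rewrite divr_gt0.
have /= Sij := second_difference i j sf Ux e2.
have /= Sji := second_difference j i sf Ux e2.
have [h [h0 [+ +]]] :=
  filter_ex (filterI (nbhs_right_gt (0 : R)) (filterI Sji Sij)).
rewrite [x + _ + _]addrAC.
set A := (X in `|X - _| <= _ -> _ -> _).
set B := (X in _ -> `|X - _| <= _ -> _).
have -> : B = A by rewrite /A /B; ring.
move: (partial i _ x) (partial j _ x) A => p q A H1 H2.
have h20 : 0 < h ^+ 2 by exact: exprn_gt0.
rewrite -(ler_pM2r h20) -[h ^+ 2 in X in X <= _]gtr0_norm // -normrM mulrBl.
rewrite (le_trans (ler_distD A _ _)) // distrC [e]splitr mulrDl.
exact: lerD.
Qed.
End Smooth.

(** * Matrix-valued functions *)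

(* This definition and the similar ones below are locked because rewriting would
   otherwise unfold them down to sums of derivatives when it compares two
   instances with different indices. *)
HB.lock Definition partial_mx (R : realType) (n p q : nat) (i : 'I_n)
    (F : 'rV[R]_n -> 'M[R]_(p, q)) (x : 'rV[R]_n) : 'M[R]_(p, q) :=
  \matrix_(a, b) partial i (fun y => F y a b) x.

Definition smooth_mx (R : realType) (n p q : nat) (U : set 'rV[R]_n)
    (F : 'rV[R]_n -> 'M[R]_(p, q)) : Prop :=
  forall a b, smooth_on U (fun y => F y a b).

Section SmoothMatrix.
Context {R : realType} {n : nat} (U : set 'rV[R]_n) (oU : open U).

Lemma partial_mxE p q i (F : 'rV[R]_n -> 'M[R]_(p, q)) x a b :
  partial_mx i F x a b = partial i (fun y => F y a b) x.
Proof. by rewrite partial_mx.unlock mxE. Qed.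

Lemma smooth_mx_partial p q i (F : 'rV[R]_n -> 'M[R]_(p, q)) :
  smooth_mx U F -> smooth_mx U (partial_mx i F).
Proof.
move=> sF a b; apply: smooth_on_ext (smooth_on_partial i (sF a b)) => // y _.
by rewrite partial_mxE.
Qed.

Lemma smooth_mxD p q (F K : 'rV[R]_n -> 'M[R]_(p, q)) :
  smooth_mx U F -> smooth_mx U K -> smooth_mx U (fun y => F y + K y).
Proof.
move=> sF sK a b; apply: smooth_on_ext (smooth_onD oU (sF a b) (sK a b)) => //.
by move=> y _; rewrite mxE.
Qed.

Lemma smooth_mxN p q (F : 'rV[R]_n -> 'M[R]_(p, q)) :
  smooth_mx U F -> smooth_mx U (fun y => - F y).
Proof.
move=> sF a b; apply: smooth_on_ext (smooth_onN oU (sF a b)) => //.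
by move=> y _; rewrite mxE.
Qed.

Lemma smooth_mxM p q r (F : 'rV[R]_n -> 'M[R]_(p, q))
    (K : 'rV[R]_n -> 'M[R]_(q, r)) :
  smooth_mx U F -> smooth_mx U K -> smooth_mx U (fun y => F y *m K y).
Proof.
move=> sF sK a b.
apply: smooth_on_ext (smooth_on_sum oU
  (fun c => smooth_onM oU (sF a c) (sK c b))) => //.
by move=> y _; rewrite mxE.
Qed.

Lemma smooth_mx_tr p q (F : 'rV[R]_n -> 'M[R]_(p, q)) :
  smooth_mx U F -> smooth_mx U (fun y => (F y)^T).
Proof.
by move=> sF a b; apply: smooth_on_ext (sF b a) => // y _; rewrite mxE.
Qed.

Lemma smooth_on_det p (F : 'rV[R]_n -> 'M[R]_p) :
  smooth_mx U F -> smooth_on U (fun y => \det (F y)).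
Proof.
move=> sF; apply: smooth_on_sum => // s; apply: smooth_onM => //.
  exact: smooth_on_cst.
by apply: smooth_on_prod => // a; exact: sF.
Qed.

(** Cramer's rule: the entries of the inverse are cofactors divided by the determinant. *)
Lemma smooth_mx_inv p (F : 'rV[R]_n -> 'M[R]_p) :
  (forall y, U y -> F y \in unitmx) -> smooth_mx U F ->
  smooth_mx U (fun y => invmx (F y)).
Proof.
move=> uF sF a b.
have sV : smooth_on U (fun y => (\det (F y))^-1).
  apply: smooth_onV => //; last exact: smooth_on_det.
  by move=> y Uy; have := uF y Uy; rewrite unitmxE unitfE.
have sA : smooth_on U (fun y => \adj (F y) a b).
  have sm : smooth_on U
      (fun y => (-1) ^+ (b + a) * \det (row' b (col' a (F y)))).
    apply: smooth_onM => //; first exact: smooth_on_cst.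
    apply: smooth_on_det => c d.
    by apply: smooth_on_ext (sF (lift b c) (lift a d)) => // y _; rewrite !mxE.
  by apply: smooth_on_ext sm => // y _; rewrite mxE.
(* [invmx] is the identity on singular matrices, so this formula is available on U only. *)
apply: smooth_on_ext (smooth_onM oU sV sA) => // y Uy.
by rewrite /invmx uF // [RHS]mxE.
Qed.

Section Pointwise.
Variables (x : 'rV[R]_n) (Ux : U x).

Lemma partial_mx_ext p q i (F K : 'rV[R]_n -> 'M[R]_(p, q)) :
  (forall y, U y -> F y = K y) -> partial_mx i F x = partial_mx i K x.
Proof.
move=> FK; apply/matrixP => a b; rewrite !partial_mxE.
by apply: (partial_ext oU) => // y Uy; rewrite FK.
Qed.

Lemma partial_mxD p q i (F K : 'rV[R]_n -> 'M[R]_(p, q)) :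
  smooth_mx U F -> smooth_mx U K ->
  partial_mx i (fun y => F y + K y) x = partial_mx i F x + partial_mx i K x.
Proof.
move=> sF sK; apply/matrixP => a b; rewrite mxE !partial_mxE.
under eq_fun do rewrite mxE.
exact: partialD (sF a b) (sK a b) Ux.
Qed.

Lemma partial_mxN p q i (F : 'rV[R]_n -> 'M[R]_(p, q)) :
  smooth_mx U F ->
  partial_mx i (fun y => - F y) x = - partial_mx i F x.
Proof.
move=> sF; apply/matrixP => a b; rewrite mxE !partial_mxE.
under eq_fun do rewrite mxE.
exact: partialN (sF a b) Ux.
Qed.

Lemma partial_mxM p q r i (F : 'rV[R]_n -> 'M[R]_(p, q))
    (K : 'rV[R]_n -> 'M[R]_(q, r)) :
  smooth_mx U F -> smooth_mx U K ->
  partial_mx i (fun y => F y *m K y) x =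
  partial_mx i F x *m K x + F x *m partial_mx i K x.
Proof.
move=> sF sK; apply/matrixP => a b; rewrite partial_mxE 3!mxE.
under eq_fun do rewrite mxE.
rewrite (partial_sum oU) //; last by move=> c; apply: smooth_onM.
rewrite -big_split /=; apply: eq_bigr => c _; rewrite !partial_mxE.
exact: partialM (sF a c) (sK c b) Ux.
Qed.

Lemma partial_mx_tr p q i (F : 'rV[R]_n -> 'M[R]_(p, q)) :
  partial_mx i (fun y => (F y)^T) x = (partial_mx i F x)^T.
Proof.
apply/matrixP => a b; rewrite mxE !partial_mxE.
by under eq_fun do rewrite mxE.
Qed.

Lemma partial_mxC p q i j (F : 'rV[R]_n -> 'M[R]_(p, q)) :
  smooth_mx U F ->
  partial_mx i (partial_mx j F) x = partial_mx j (partial_mx i F) x.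
Proof.
move=> sF; apply/matrixP => a b.
have E k l : partial_mx k (partial_mx l F) x a b =
    partial k (partial l (fun y => F y a b)) x.
  rewrite partial_mxE; congr (partial k _ x); apply/funext => y.
  by rewrite partial_mxE.
apply: (etrans (E i j)); apply: (etrans _ (esym (E j i))).
exact: (partialC oU i j (sF a b) Ux).
Qed.

End Pointwise.
End SmoothMatrix.

(** * Bianchi identities *)

Lemma trmxD (R : pzRingType) p q (A B : 'M[R]_(p, q)) :
  (A + B)^T = A^T + B^T.
Proof. exact: linearD. Qed.

Lemma trmxN (R : pzRingType) p q (A : 'M[R]_(p, q)) : (- A)^T = - A^T.
Proof. exact: linearN. Qed.

Lemma addmxE (R : pzRingType) p q (A B : 'M[R]_(p, q)) a b :
  (A + B) a b = A a b + B a b.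
Proof. exact: mxE. Qed.

Lemma oppmxE (R : pzRingType) p q (A : 'M[R]_(p, q)) a b :
  (- A) a b = - A a b.
Proof. exact: mxE. Qed.

(* The connection form: [conn G i] is the matrix (Gamma^k_il)_kl. *)
HB.lock Definition conn (R : realType) (n : nat) (G : 'rV[R]_n -> 'M[R]_n)
    (i : 'I_n) (x : 'rV[R]_n) : 'M[R]_n :=
  \matrix_(k, l) christoffel G k i l x.

(* [curv G i j] is the matrix (R^k_lij)_kl. *)
HB.lock Definition curv (R : realType) (n : nat) (G : 'rV[R]_n -> 'M[R]_n)
    (i j : 'I_n) (x : 'rV[R]_n) : 'M[R]_n :=
  partial_mx i (conn G j) x - partial_mx j (conn G i) x
  + (conn G i x *m conn G j x - conn G j x *m conn G i x).

(* [nabla_curv G m i j] is the matrix (nabla_m R^k_lij)_kl. *)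
HB.lock Definition nabla_curv (R : realType) (n : nat)
    (G : 'rV[R]_n -> 'M[R]_n) (m i j : 'I_n) (x : 'rV[R]_n) : 'M[R]_n :=
  partial_mx m (curv G i j) x
  + (conn G m x *m curv G i j x - curv G i j x *m conn G m x)
  - \sum_p conn G m x p i *: curv G p j x
  - \sum_p conn G m x p j *: curv G i p x.

HB.lock Definition ric (R : realType) (n : nat) (G : 'rV[R]_n -> 'M[R]_n)
    (x : 'rV[R]_n) : 'M[R]_n := \matrix_(i, j) ricci G i j x.

(** The matrix (nabla_m R_ij)_ij: each of the two lower indices costs one product with the
    connection matrix. *)
HB.lock Definition nabla_ric (R : realType) (n : nat)
    (G : 'rV[R]_n -> 'M[R]_n) (m : 'I_n) (x : 'rV[R]_n) : 'M[R]_n :=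
  partial_mx m (ric G) x - (conn G m x)^T *m ric G x - ric G x *m conn G m x.

Section Curvature.
Context {R : realType} {n : nat} (U : set 'rV[R]_n) (oU : open U).
Variable G : 'rV[R]_n -> 'M[R]_n.
Hypothesis G_smooth : smooth_mx U G.
Hypothesis G_sym : forall y, U y -> (G y)^T = G y.
Hypothesis G_unit : forall y, U y -> G y \in unitmx.
Implicit Types (x y : 'rV[R]_n) (i j k l m : 'I_n).

Local Notation conn := (conn G).
Local Notation curv := (curv G).
Local Notation nabla_curv := (nabla_curv G).
Local Notation ric := (ric G).
Local Notation nabla_ric := (nabla_ric G).

Lemma connE i x k l : conn i x k l = christoffel G k i l x.
Proof. by rewrite conn.unlock mxE. Qed.

Lemma conn_smooth i : smooth_mx U (conn i).
Proof.
move=> k l; apply: (@smooth_on_ext _ _ _ oU (christoffel G k i l)).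
  by move=> y _; rewrite connE.
apply: smooth_onM => //; first exact: smooth_on_cst.
apply: smooth_on_sum => // m; apply: smooth_onM => //.
  exact: smooth_mx_inv.
by apply: smooth_onB => //; first apply: smooth_onD => //;
  apply: smooth_on_partial; exact: G_smooth.
Qed.

Lemma curv_smooth i j : smooth_mx U (curv i j).
Proof.
rewrite curv.unlock; do 2!apply: smooth_mxD => //;
  try apply: smooth_mxN => //; try apply: smooth_mxM => //;
  try apply: smooth_mx_partial => //;
  exact: conn_smooth.
Qed.

Section Pointwise.
Variables (x : 'rV[R]_n) (Ux : U x).

Lemma near_G_sym : \forall y \near x, (G y)^T = G y.
Proof. by apply: filterS (near_open oU Ux). Qed.

Lemma connC i j k : conn i x k j = conn j x k i.
Proof. by rewrite !connE; apply: christoffelC near_G_sym _ _ _. Qed.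

(** This is nabla g = 0 solved for the derivative of g; it eliminates such derivatives from the
    matrix computations below. *)
Lemma partial_G k :
  partial_mx k G x = (conn k x)^T *m G x + G x *m conn k x.
Proof.
apply/matrixP => i j; rewrite partial_mxE 3!mxE.
have /eqP := nabla_metric near_G_sym k i j (G_unit Ux).
rewrite /nabla_02 -addrA -opprD subr_eq0 => /eqP ->.
by congr (_ + _); apply: eq_bigr => m _;
  [rewrite mxE connE | rewrite connE mulrC].
Qed.

Lemma curv_entry i j k l : curv i j x k l =
  partial_mx i (conn j) x k l - partial_mx j (conn i) x k l
  + ((conn i x *m conn j x) k l - (conn j x *m conn i x) k l).
Proof. by rewrite curv.unlock addmxE !addmxE !oppmxE. Qed.

(** The derivative nabla_j of the l-th coordinate field has components Gamma^k_jl. Differentiating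
    again produces d_i Gamma_j + Gamma_i Gamma_j and a term Gamma^m_ij Gamma_m, which is symmetric
    in i, j and cancels on antisymmetrization. *)
Lemma riemann_upE k l i j : riemann_up G k l i j x = curv i j x k l.
Proof.
have nvE a b : nabla_vector G (coord_field l) a b = fun y => conn a y b l.
  apply/funext => y.
  rewrite /nabla_vector /coord_field partial_cst add0r connE (bigD1 l) //=.
  by rewrite eqxx mulr1 big1 ?addr0 // => m /negPf ->; rewrite mulr0.
have n2E a b : nabla2_vector G (coord_field l) a b k x =
    partial_mx a (conn b) x k l + (conn a x *m conn b x) k l
    - \sum_m christoffel G m a b x * conn m x k l.
  rewrite /nabla2_vector /nabla_11 /= nvE partial_mxE [X in _ = _ + X - _]mxE.
  congr (_ + _ - _).
    by apply: eq_bigr => m _; rewrite nvE -connE.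
  by apply: eq_bigr => m _; rewrite nvE.
rewrite /riemann_up !n2E.
under [X in _ - (_ - X)]eq_bigr => m _ do
  rewrite (christoffelC near_G_sym).
by rewrite curv_entry opprB addrA subrK opprD addrACA.
Qed.

Lemma curvC i j : curv i j x = - curv j i x.
Proof. by rewrite curv.unlock opprD !opprB. Qed.

Lemma riemannE k l i j : riemann G k l i j x = (G x *m curv i j x) k l.
Proof.
by rewrite mxE; apply: eq_bigr => m _; rewrite riemann_upE.
Qed.

Lemma ricE i j : ric x i j = \sum_k curv k j x k i.
Proof.
by rewrite ric.unlock mxE; apply: eq_bigr => k _; rewrite riemann_upE.
Qed.

End Pointwise.

Section Bianchi.
Variables (x : 'rV[R]_n) (Ux : U x).

(** By the absence of torsion, (d_a Gamma_b)^k_c and (Gamma_a Gamma_b)^k_c are symmetric in b and c;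
    the cyclic sum then cancels in pairs. *)
Lemma curv_bianchi1 i j k l :
  curv i j x k l + curv j l x k i + curv l i x k j = 0.
Proof.
pose D a b c := partial_mx a (conn b) x k c.
pose M a b c := (conn a x *m conn b x) k c.
have dC a b c : D a b c = D a c b.
  rewrite /D !partial_mxE; apply: (partial_ext oU) => // y Uy.
  exact: connC.
have mC a b c : M a b c = M a c b.
  rewrite /M [LHS]mxE [RHS]mxE; apply: eq_bigr => m _.
  by congr (_ * _); exact: connC.
have cE a b c : curv a b x k c = D a b c - D b a c + (M a b c - M b a c).
  exact: curv_entry.
clearbody D M.
rewrite (cE i j l) (cE j l i) (cE l i j).
rewrite (dC i l j) (dC j l i) (dC l j i) (mC i l j) (mC j l i) (mC l j i).
ring.
Qed.

(* Ricci identity for the parallel tensor g: [d_i, d_j] g = 0 reads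
   (R_ij)^T g + g R_ij = 0. *)
Lemma curv_skew i j : (G x *m curv i j x)^T = - (G x *m curv i j x).
Proof.
have ddG a b : partial_mx a (partial_mx b G) x =
    (partial_mx a (conn b) x)^T *m G x
    + (conn b x)^T *m ((conn a x)^T *m G x + G x *m conn a x)
    + (((conn a x)^T *m G x + G x *m conn a x) *m conn b x
       + G x *m partial_mx a (conn b) x).
  have sb := conn_smooth b; have sbt := smooth_mx_tr oU sb.
  rewrite (partial_mx_ext oU Ux a (fun y Uy => partial_G Uy b)).
  rewrite (partial_mxD Ux); try by apply: smooth_mxM.
  rewrite (partial_mxM oU Ux) // (partial_mxM oU Ux) //.
  by rewrite partial_mx_tr partial_G.
have := partial_mxC oU Ux i j G_smooth; rewrite !ddG.
rewrite trmx_mul (G_sym Ux) curv.unlock.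
move: (conn i x) (conn j x) (partial_mx i _ x) (partial_mx j _ x) (G x).
clear => A B dB dA g.
rewrite !(trmxD, trmxN) !trmx_mul.
(* Matrices do not commute, so everything is expanded into products whose entries serve as atoms for
   [ring]. *)
rewrite !(mulmxDl, mulmxDr, mulmxN, mulNmx, mulmxA) => /matrixP E.
apply/matrixP => a b; have := E a b; rewrite !(addmxE, oppmxE) => /eqP.
rewrite -subr_eq0 => /eqP {}E; apply/eqP; rewrite -subr_eq0 -E; apply/eqP.
ring.
Qed.

(** In the cyclic sum the second derivatives of Gamma cancel by their symmetry, and the remaining
    products against the commutators [Gamma_m, R_ij]. *)
Lemma nabla_curv_bianchi2 m i j :
  nabla_curv m i j x + nabla_curv i j m x + nabla_curv j m i x = 0.
Proof.
have dE a b c : partial_mx a (curv b c) x =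
    partial_mx a (partial_mx b (conn c)) x
    - partial_mx a (partial_mx c (conn b)) x
    + ((partial_mx a (conn b) x *m conn c x
        + conn b x *m partial_mx a (conn c) x)
       - (partial_mx a (conn c) x *m conn b x
          + conn c x *m partial_mx a (conn b) x)).
  have sm d := conn_smooth d; have sp d e := smooth_mx_partial oU d (sm e).
  rewrite curv.unlock (partial_mxD Ux); last 2 first.
  - by apply: smooth_mxD => //; apply: smooth_mxN.
  - by apply: smooth_mxD => //; [|apply: smooth_mxN => //]; apply: smooth_mxM.
  rewrite (partial_mxD Ux) //; last exact: smooth_mxN.
  rewrite (partial_mxD Ux); last 2 first.
  - exact: smooth_mxM.
  - by apply: smooth_mxN => //; apply: smooth_mxM.
  rewrite (partial_mxN Ux) // (partial_mxN Ux); last exact: smooth_mxM.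
  by rewrite !(partial_mxM oU Ux).
(* By symmetry of Gamma and skewness of R, the correction for the second form index is opposite to
   the correction for the first one in another term of the cyclic sum. *)
have cS a b c : \sum_p conn a x p b *: curv c p x =
    - \sum_p conn b x p a *: curv p c x.
  rewrite -sumrN; apply: eq_bigr => p _.
  by rewrite curvC scalerN (connC Ux).
rewrite nabla_curv.unlock !cS !dE (partial_mxC oU Ux m j)
  ?(partial_mxC oU Ux i m) ?(partial_mxC oU Ux j i); try exact: conn_smooth.
rewrite curv.unlock !(mulmxDl, mulmxDr, mulmxN, mulNmx, mulmxA).
apply/matrixP => a b; rewrite !(addmxE, oppmxE) [RHS]mxE.
ring.
Qed.

End Bianchi.
End Curvature.

(** * Contractions of the curvature and of its derivative *)

Section Contraction.
Context {R : realType} {n : nat} (U : set 'rV[R]_n) (oU : open U).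
Variable G : 'rV[R]_n -> 'M[R]_n.
Hypothesis G_smooth : smooth_mx U G.
Hypothesis G_sym : forall y, U y -> (G y)^T = G y.
Hypothesis G_unit : forall y, U y -> G y \in unitmx.
Implicit Types (x y : 'rV[R]_n) (i j k l m : 'I_n).
Local Notation conn := (conn G).
Local Notation curv := (curv G).
Local Notation nabla_curv := (nabla_curv G).
Local Notation ric := (ric G).
Local Notation nabla_ric := (nabla_ric G).

Let sconn i : smooth_mx U (conn i) := conn_smooth oU G_smooth G_unit i.
Let scurv i j : smooth_mx U (curv i j) := curv_smooth oU G_smooth G_unit i j.

Lemma mxtraceN (A : 'M[R]_n) : \tr (- A) = - \tr A.
Proof. exact: raddfN. Qed.

Lemma mxtrace_sym_skew (H S : 'M[R]_n) : H^T = H -> S^T = - S ->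
  \tr (H *m S) = 0.
Proof.
move=> Hs Ss; have : \tr (H *m S) *+ 2 = 0.
  rewrite mulr2n -{2}mxtrace_tr trmx_mul Hs Ss mulNmx mxtraceN mxtrace_mulC.
  exact: subrr.
by move/eqP; rewrite mulrn_eq0 => /eqP.
Qed.

Lemma ric_smooth : smooth_mx U ric.
Proof.
move=> a b.
apply: smooth_on_ext (smooth_on_sum oU (fun k => scurv k b k a)) => //.
by move=> y Uy; rewrite (ricE oU G_sym).
Qed.

(** Contracting the first Bianchi identity expresses R_ij - R_ji by the trace of the matrix R_ji.
    That trace vanishes, R_ji being the product of the symmetric g^-1 and the skew g R_ji. *)
Lemma ricC x i j : U x -> ric x i j = ric x j i.
Proof.
move=> Ux; have tr0 : \tr (curv j i x) = 0.
  rewrite -[curv j i x](mulKmx (G_unit Ux)); apply: mxtrace_sym_skew.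
    by rewrite trmx_inv G_sym.
  exact: curv_skew Ux j i.
rewrite !(ricE oU G_sym) //; apply/eqP; rewrite -subr_eq0 -sumrB; apply/eqP.
transitivity (- \tr (curv j i x)); last by rewrite tr0 oppr0.
rewrite -sumrN; apply: eq_bigr => k _.
have := curv_bianchi1 oU G_sym Ux k j k i.
by rewrite (curvC G x i k) oppmxE => /eqP; rewrite addrAC addr_eq0 => /eqP.
Qed.

Section Pointwise.
Variables (x : 'rV[R]_n) (Ux : U x).

Lemma nabla_curvC m i j : nabla_curv m i j x = - nabla_curv m j i x.
Proof.
have pC : partial_mx m (curv i j) x = - partial_mx m (curv j i) x.
  rewrite -(partial_mxN Ux) //.
  by apply: (partial_mx_ext oU Ux) => y _; exact: curvC.
have sC (a b : 'I_n) : \sum_p conn m x p a *: curv b p x =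
    - \sum_p conn m x p a *: curv p b x.
  by rewrite -sumrN; apply: eq_bigr => p _; rewrite curvC scalerN.
rewrite nabla_curv.unlock pC (curvC G x i j) !sC.
rewrite mulmxN mulNmx !opprD !opprK.
by rewrite addrAC.
Qed.

(** Lowering an index commutes with nabla because g is parallel; the right-hand side is the
    covariant derivative of R_klij. *)
Lemma nabla_curv_lower m i j : G x *m nabla_curv m i j x =
  partial_mx m (fun y => G y *m curv i j y) x
  - (conn m x)^T *m (G x *m curv i j x) - (G x *m curv i j x) *m conn m x
  - \sum_p conn m x p i *: (G x *m curv p j x)
  - \sum_p conn m x p j *: (G x *m curv i p x).
Proof.
rewrite (partial_mxM oU Ux) // (partial_G oU G_sym G_unit Ux) nabla_curv.unlock.
under [X in _ = _ - X - _]eq_bigr do rewrite scalemxAr.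
under [X in _ = _ - X]eq_bigr do rewrite scalemxAr.
rewrite -!mulmx_sumr !mulmxBr; congr (_ - _ - _).
rewrite mulmxDr mulmxBr mulmxDl !mulmxA.
by apply/matrixP => a b; rewrite !(addmxE, oppmxE); ring.
Qed.

(** With the index lowered, nabla inherits the skewness of g R_ij: transposition exchanges the two
    terms in Gamma_m up to sign. *)
Lemma nabla_curv_skew m i j :
  (G x *m nabla_curv m i j x)^T = - (G x *m nabla_curv m i j x).
Proof.
have sk a b : (G x *m curv a b x)^T = - (G x *m curv a b x).
  exact: curv_skew Ux a b.
have pk : (partial_mx m (fun y => G y *m curv i j y) x)^T =
    - partial_mx m (fun y => G y *m curv i j y) x.
  rewrite -partial_mx_tr -(partial_mxN Ux); last exact: smooth_mxM.
  apply: (partial_mx_ext oU Ux) => y Uy.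
  exact: curv_skew Uy i j.
have sumk (c : 'I_n -> R) (K : 'I_n -> 'M[R]_n) :
    (forall p, (K p)^T = - K p) -> (\sum_p c p *: K p)^T = - \sum_p c p *: K p.
  move=> Kk; rewrite raddf_sum -sumrN; apply: eq_bigr => p _.
  by rewrite -scalerN -Kk; exact: linearZ.
rewrite nabla_curv_lower.
set S1 := \sum_p _; set S2 := \sum_p _.
have S1k : S1^T = - S1 by apply: sumk => p; exact: sk.
have S2k : S2^T = - S2 by apply: sumk => p; exact: sk.
move: (sk i j) pk S1k S2k.
move: (G x *m curv i j x) (partial_mx _ _ _) (conn _ _) S1 S2.
clear => K D A S1 S2 Kk Dk S1k S2k.
rewrite !(trmxD, trmxN) Dk S1k S2k !trmx_mul Kk trmxK mulNmx mulmxN.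
by apply/matrixP => a b; rewrite !(addmxE, oppmxE); ring.
Qed.

(** Contraction commutes with nabla: the corrections for the contracted upper and lower index cancel
    once the two summations are exchanged. *)
Lemma nabla_ricE m i j : nabla_ric m x i j = \sum_k nabla_curv m k j x k i.
Proof.
have pric : partial_mx m ric x i j = \sum_k partial_mx m (curv k j) x k i.
  rewrite partial_mxE (partial_ext oU m Ux (fun y Uy => ricE oU G_sym Uy i j)).
  rewrite (partial_sum oU) //; last by move=> k; exact: scurv.
  by apply: eq_bigr => k _; rewrite partial_mxE.
have nE k : nabla_curv m k j x k i =
    partial_mx m (curv k j) x k i
    + (\sum_p conn m x k p * curv k j x p i
       - \sum_p curv k j x k p * conn m x p i)
    - \sum_p conn m x p k * curv p j x k i
    - \sum_p conn m x p j * curv k p x k i.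
  rewrite nabla_curv.unlock 3!addmxE 2!oppmxE addmxE oppmxE.
  congr (_ + (_ - _) - _ - _); rewrite ?[LHS]mxE // summxE.
    by apply: eq_bigr => p _; rewrite mxE.
  by apply: eq_bigr => p _; rewrite mxE.
under [RHS]eq_bigr do rewrite nE.
have tE : ((conn m x)^T *m ric x) i j =
    \sum_k \sum_p curv k j x k p * conn m x p i.
  rewrite mxE exchange_big; apply: eq_bigr => p _.
  by rewrite mxE (ricE oU G_sym Ux) mulrC mulr_suml.
have rE : (ric x *m conn m x) i j =
    \sum_k \sum_p conn m x p j * curv k p x k i.
  rewrite mxE exchange_big; apply: eq_bigr => p _.
  by rewrite (ricE oU G_sym Ux) mulrC mulr_sumr.
rewrite !sumrB big_split /= sumrB [X in _ = _ + (X - _) - _ - _]exchange_big /=.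
rewrite nabla_ric.unlock addmxE oppmxE addmxE oppmxE pric tE rE.
by rewrite [in RHS]addrA [X in _ = X - _ - _]addrAC addrK.
Qed.

(** The second Bianchi identity with the upper index contracted against m; the two other terms
    become derivatives of Ric by [nabla_ricE]. *)
Lemma divergence_curv i j k :
  \sum_m nabla_curv m j k x m i = nabla_ric j x i k - nabla_ric k x i j.
Proof.
rewrite !nabla_ricE -sumrB; apply: eq_bigr => m _.
have := nabla_curv_bianchi2 oU G_smooth G_sym G_unit Ux m j k.
rewrite (nabla_curvC j k m) => /matrixP/(_ m i).
rewrite addmxE addmxE oppmxE [RHS]mxE => /eqP.
by rewrite -addrA addr_eq0 opprD opprK => /eqP.
Qed.

Lemma nabla_ricC m i j : nabla_ric m x i j = nabla_ric m x j i.
Proof.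
have rT y : U y -> (ric y)^T = ric y.
  by move=> Uy; apply/matrixP => a b; rewrite mxE ricC.
suff /matrixP/(_ j i) : (nabla_ric m x)^T = nabla_ric m x by rewrite mxE.
rewrite nabla_ric.unlock !(trmxD, trmxN) !trmx_mul trmxK (rT x Ux) addrAC.
by rewrite -partial_mx_tr (partial_mx_ext oU Ux m rT).
Qed.

(** Obtained by differentiating g^-1 g = 1; it says that the inverse metric is parallel. *)
Lemma partial_invmx m : partial_mx m (fun y => invmx (G y)) x =
  - (conn m x *m invmx (G x) + invmx (G x) *m (conn m x)^T).
Proof.
have sV := smooth_mx_inv oU G_unit G_smooth.
have : partial_mx m (fun y => invmx (G y) *m G y) x = 0.
  have VG y : U y -> invmx (G y) *m G y = 1%:M.
    by move=> Uy; rewrite mulVmx ?G_unit.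
  rewrite (partial_mx_ext oU Ux m VG).
  by apply/matrixP => a b; rewrite partial_mxE partial_cst mxE.
rewrite (partial_mxM oU Ux) // (partial_G oU G_sym G_unit Ux) => /eqP.
rewrite addr_eq0 => /eqP /(congr1 (mulmx^~ (invmx (G x)))).
rewrite mulmxK ?G_unit // => ->.
rewrite mulNmx mulmxDr mulmxDl !mulmxA mulVmx ?G_unit // mul1mx.
by rewrite mulmxK ?G_unit // addrC.
Qed.

Lemma mxtrace_mul_tr (A B : 'M[R]_n) :
  \tr (A^T *m B) = \sum_i \sum_j A i j * B i j.
Proof.
rewrite exchange_big; apply: eq_bigr => j _; rewrite mxE.
by apply: eq_bigr => i _; rewrite mxE.
Qed.

(** Written as traces, the connection terms from the derivative of g^-1 and those in nabla Ric agree
    by cyclicity. *)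
Lemma partial_scalar m : partial m (scalar_curvature G) x =
  \sum_i \sum_j cometric G i j x * nabla_ric m x i j.
Proof.
have sV := smooth_mx_inv oU G_unit G_smooth.
have sE y : scalar_curvature G y =
    \sum_i \sum_j invmx (G y) i j * ric y i j.
  rewrite ric.unlock; apply: eq_bigr => i _; apply: eq_bigr => j _.
  by rewrite mxE.
have -> : scalar_curvature G =
    fun y => \sum_i \sum_j invmx (G y) i j * ric y i j.
  by apply/funext.
have sr := ric_smooth.
rewrite (partial_sum oU) //; last first.
  by move=> i; apply: smooth_on_sum => // j; apply: smooth_onM.
under eq_bigr => i _.
  rewrite (partial_sum oU) //; last by move=> j; apply: smooth_onM.
  under eq_bigr => j _ do
    rewrite (partialM m (sV i j) (sr i j) Ux) -!partial_mxE.
  rewrite big_split.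
  over.
rewrite big_split /= /cometric -!mxtrace_mul_tr partial_invmx nabla_ric.unlock.
have HT : (invmx (G x))^T = invmx (G x) by rewrite trmx_inv G_sym.
rewrite trmxN trmxD !trmx_mul trmxK HT.
rewrite !mulmxBr mulNmx mulmxDl !(mxtraceD, mxtraceN).
rewrite !mulmxA [\tr (_ *m conn m x)]mxtrace_mulC !mulmxA.
ring.
Qed.

(** The double contraction of nabla_m R^m_ijk with g^ik is computed twice: [divergence_curv] gives
    ds - div Ric, and the skew symmetries of R give div Ric. *)
Lemma contracted_bianchi j : partial j (scalar_curvature G) x =
  2 * \sum_i \sum_m cometric G i m x * nabla_ric m x i j.
Proof.
set S := \sum_i _.
have HT : (invmx (G x))^T = invmx (G x) by rewrite trmx_inv G_sym.
have E1 : \sum_i \sum_k invmx (G x) i k * \sum_m nabla_curv m j k x m i =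
    partial j (scalar_curvature G) x - S.
  rewrite partial_scalar -sumrB; apply: eq_bigr => i _.
  rewrite -sumrB; apply: eq_bigr => k _.
  by rewrite divergence_curv mulrBr.
have skH m k : (nabla_curv m j k x *m invmx (G x))^T =
    - (nabla_curv m j k x *m invmx (G x)).
  rewrite -[nabla_curv m j k x](mulKmx (G_unit Ux)).
  by rewrite -mulmxA trmx_mul trmx_mul nabla_curv_skew HT mulmxN mulNmx mulmxA.
have E2 : \sum_i \sum_k invmx (G x) i k * \sum_m nabla_curv m j k x m i = S.
  transitivity (\sum_m \sum_k (nabla_curv m j k x *m invmx (G x)) m k).
    transitivity (\sum_i \sum_k \sum_m
        nabla_curv m j k x m i * invmx (G x) i k).
      apply: eq_bigr => i _; apply: eq_bigr => k _.
      by rewrite mulrC mulr_suml.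
    under [LHS]eq_bigr do rewrite exchange_big.
    rewrite exchange_big; apply: eq_bigr => m _.
    by rewrite exchange_big; apply: eq_bigr => k _; rewrite mxE.
  (* Skewness in both index pairs brings the contracted index k to the position required by
     [nabla_ricE]. *)
  have skE m k : (nabla_curv m j k x *m invmx (G x)) m k =
      (nabla_curv m k j x *m invmx (G x)) k m.
    have /matrixP/(_ k m) := skH m k; rewrite mxE => ->.
    by rewrite -mulNmx -nabla_curvC.
  under eq_bigr => m _ do under eq_bigr => k _ do rewrite skE mxE.
  rewrite /S [RHS]exchange_big; apply: eq_bigr => m _.
  rewrite exchange_big; apply: eq_bigr => i _.
  by rewrite nabla_ricE mulr_sumr; apply: eq_bigr => k _; rewrite mulrC.
by move: E1; rewrite E2 => /eqP; rewrite eq_sym subr_eq => /eqP ->; ring.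
Qed.

End Pointwise.
End Contraction.

(** * Divergence of the Weyl projective curvature tensor *)

(* Applied with K m i j = nabla_m R_ij and s j = d_j s; the left-hand side of the
   equivalence is then the Omega_2 condition. *)
Lemma codazzi_trace_reversal (R : realFieldType) (n : nat) (g H : 'M[R]_n)
    (s : 'I_n -> R) (K : 'I_n -> 'I_n -> 'I_n -> R) :
  (2 < n)%N -> H *m g = 1%:M -> g^T = g ->
  (forall m i j, K m i j = K m j i) ->
  (forall j, \sum_i \sum_m H i m * K j i m = s j) ->
  (forall j, s j = 2 * \sum_i \sum_m H i m * K m i j) ->
  (forall i j k,
    K k i j - 2^-1 * s k * g i j = K i k j - 2^-1 * s i * g k j) <->
  (forall i j k, K j i k = K k i j).
Proof.
move=> n2 Hg gT KC tr1 div.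
have HT : H^T = H.
  have gH := mulmx1C Hg; rewrite -[LHS]mulmx1 -gH mulmxA.
  by rewrite -{1}gT -trmx_mul gH trmx1 mul1mx.
have tr2 i : \sum_k \sum_j H k j * K k i j = 2^-1 * s i.
  rewrite div mulKf ?pnatr_eq0 // exchange_big.
  apply: eq_bigr => k _; apply: eq_bigr => m _.
  by rewrite KC -[in LHS]HT mxE.
have Hgd b c : \sum_j H b j * g c j = (b == c)%:R.
  have /matrixP/(_ b c) := Hg; rewrite mxE [RHS]mxE => <-.
  by apply: eq_bigr => d _; rewrite -[in LHS]gT mxE.
(* Covers both sides of the Omega_2 condition: d is constant on the left, where a single Kronecker
   delta survives, and the identity on the right, where the trace n appears. *)
have contract (F : 'I_n -> 'I_n -> R) (d : 'I_n -> 'I_n) (u : 'I_n -> R) :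
    \sum_k \sum_j H k j * (F k j - u k * g (d k) j) =
    \sum_k \sum_j H k j * F k j - \sum_k u k * (k == d k)%:R.
  rewrite -sumrB; apply: eq_bigr => k _.
  rewrite -Hgd mulr_sumr -sumrB; apply: eq_bigr => j _.
  by rewrite mulrBr mulrCA.
split=> [Om i j k|Kd i j k].
- have s0 a : s a = 0.
    have : \sum_k \sum_j H k j * (K k a j - 2^-1 * s k * g a j) =
        \sum_k \sum_j H k j * (K a k j - 2^-1 * s a * g k j).
      by apply: eq_bigr => b _; apply: eq_bigr => c _; rewrite Om.
    rewrite (contract (fun k j => K k a j) (fun=> a) (fun k => 2^-1 * s k)).
    rewrite (contract (fun k j => K a k j) id (fun=> 2^-1 * s a)) tr2 tr1.
    rewrite (bigD1 a) //= eqxx mulr1 big1 ?addr0; last first.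
      by move=> b /negPf ->; rewrite mulr0.
    under eq_bigr do rewrite eqxx mulr1.
    rewrite subrr sumr_const card_ord -[_ *+ n]mulr_natr => E.
    (* The left side contracts to s_a/2 - s_a/2 and the right side to s_a - (n/2) s_a. *)
    have /eqP : s a * (n%:R - 2) = 0 by lra.
    by rewrite mulf_eq0 subr_eq0 eqr_nat gtn_eqF // orbF => /eqP.
  have := Om j i k; rewrite !s0 mulr0 !mul0r !subr0 => E.
  by rewrite [LHS]KC -E KC.
- have s0 a : s a = 0.
    have : s a = 2^-1 * s a.
      rewrite -{1}tr1 -tr2; apply: eq_bigr => b _; apply: eq_bigr => c _.
      by rewrite [in LHS]KC (Kd c a b) KC.
    by move=> E; lra.
  by rewrite !s0 mulr0 !mul0r !subr0 KC Kd KC.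
Qed.

(** * The equivalence at a point of a chart *)

Section PointwiseEquivalence.
Context {R : realType} {n : nat} (U : set 'rV[R]_n) (oU : open U).
Variable G : 'rV[R]_n -> 'M[R]_n.
Hypothesis G_smooth : smooth_mx U G.
Hypothesis G_sym : forall y, U y -> (G y)^T = G y.
Hypothesis G_unit : forall y, U y -> G y \in unitmx.
Implicit Types (x y : 'rV[R]_n) (i j k l m : 'I_n).
Local Notation nabla_curv := (nabla_curv G).
Local Notation ric := (ric G).
Local Notation nabla_ric := (nabla_ric G).

Variables (x : 'rV[R]_n) (Ux : U x).

Let near_sym : \forall y \near x, (G y)^T = G y :=
  near_G_sym oU G_sym Ux.

Lemma smooth_on_ricci i j : smooth_on U (ricci G i j).
Proof.
apply: smooth_on_ext (ric_smooth oU G_smooth G_sym G_unit i j) => // y _.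
by rewrite ric.unlock mxE.
Qed.

Lemma smooth_on_riemann k l i j : smooth_on U (riemann G k l i j).
Proof.
have sGR := smooth_mxM oU G_smooth (curv_smooth oU G_smooth G_unit i j).
apply: smooth_on_ext (sGR k l) => // y Uy.
by rewrite (riemannE oU G_sym Uy).
Qed.

Lemma smooth_on_scalar : smooth_on U (scalar_curvature G).
Proof.
have sV := smooth_mx_inv oU G_unit G_smooth.
do 2![apply: smooth_on_sum => // ?]; apply: smooth_onM => //; first exact: sV.
exact: smooth_on_ricci.
Qed.

Lemma nabla_02_ricci m i j :
  nabla_02 G (ricci G) m i j x = nabla_ric m x i j.
Proof.
rewrite nabla_ric.unlock addmxE addmxE !oppmxE partial_mxE /nabla_02.
have -> : (fun y => ric y i j) = ricci G i j.
  by apply/funext => y; rewrite ric.unlock mxE.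
congr (_ - _ - _); rewrite mxE; apply: eq_bigr => p _.
  by rewrite mxE connE ric.unlock mxE.
by rewrite connE ric.unlock mxE mulrC.
Qed.

Lemma nabla_04_riemann m l i j k :
  nabla_04 G (riemann G) m l i j k x = (G x *m nabla_curv m j k x) l i.
Proof.
rewrite (nabla_curv_lower oU G_smooth G_sym G_unit Ux).
rewrite 4!addmxE 4!oppmxE partial_mxE !summxE /nabla_04.
rewrite (partial_ext oU m Ux (fun y Uy => riemannE oU G_sym Uy l i j k)).
congr (_ - _ - _ - _ - _); rewrite ?[RHS]mxE; apply: eq_bigr => p _;
  rewrite (riemannE oU G_sym Ux).
- by rewrite [X in _ = X * _]mxE connE.
- by rewrite connE mulrC.
- by rewrite [RHS]mxE connE.
- by rewrite [RHS]mxE connE.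
Qed.

Lemma nabla_04B (A B : 'I_n -> 'I_n -> 'I_n -> 'I_n -> 'rV[R]_n -> R)
    m l i j k :
  (forall a b c d, smooth_on U (A a b c d)) ->
  (forall a b c d, smooth_on U (B a b c d)) ->
  nabla_04 G (fun a b c d y => A a b c d y - B a b c d y) m l i j k x =
  nabla_04 G A m l i j k x - nabla_04 G B m l i j k x.
Proof.
move=> sA sB; rewrite /nabla_04 (@partialB _ _ U) //.
have E (f g h : 'I_n -> R) : \sum_p f p * (g p - h p) =
    \sum_p f p * g p - \sum_p f p * h p.
  by rewrite -sumrB; apply: eq_bigr => p _; rewrite mulrBr.
rewrite !E; ring.
Qed.

Lemma nabla_04Z (c : R) (A : 'I_n -> 'I_n -> 'I_n -> 'I_n -> 'rV[R]_n -> R)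
    m l i j k :
  (forall a b c d, smooth_on U (A a b c d)) ->
  nabla_04 G (fun a b d e y => c * A a b d e y) m l i j k x =
  c * nabla_04 G A m l i j k x.
Proof.
move=> sA; rewrite /nabla_04 (@partialM _ _ U) //; last exact: smooth_on_cst.
rewrite partial_cst.
have E (f g : 'I_n -> R) : \sum_p f p * (c * g p) = c * \sum_p f p * g p.
  by rewrite mulr_sumr; apply: eq_bigr => p _; rewrite mulrCA.
rewrite !E; ring.
Qed.

Lemma nabla_04_swap (A : 'I_n -> 'I_n -> 'I_n -> 'I_n -> 'rV[R]_n -> R)
    m l i j k :
  nabla_04 G (fun a b c d => A a b d c) m l i j k x =
  nabla_04 G A m l i k j x.
Proof. by rewrite /nabla_04 addrAC. Qed.

(** Leibniz rule with the index pairing of g_lj R_ik; the other term g_lk R_ij of P is reached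
    through [nabla_04_swap]. *)
Lemma nabla_04_tensor (A B : 'I_n -> 'I_n -> 'rV[R]_n -> R) m l i j k :
  (forall a b, smooth_on U (A a b)) -> (forall a b, smooth_on U (B a b)) ->
  nabla_04 G (fun a b c d y => A a c y * B b d y) m l i j k x =
  nabla_02 G A m l j x * B i k x + A l j x * nabla_02 G B m i k x.
Proof.
move=> sA sB; rewrite /nabla_04 /nabla_02 (@partialM _ _ U) //.
have EA (f g : 'I_n -> R) c : \sum_p f p * (g p * c) = (\sum_p f p * g p) * c.
  by rewrite mulr_suml; apply: eq_bigr => p _; rewrite mulrA.
have EB (f g : 'I_n -> R) c : \sum_p f p * (c * g p) = c * \sum_p f p * g p.
  by rewrite mulr_sumr; apply: eq_bigr => p _; rewrite mulrCA.
rewrite !EA !EB; ring.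
Qed.

(** As g is parallel, only the curvature factors of P are differentiated. *)
Lemma nabla_04_weyl m l i j k :
  nabla_04 G (weyl_projective G) m l i j k x =
  (G x *m nabla_curv m j k x) l i
  - (n%:R - 1)^-1 * (G x l j * nabla_ric m x i k - G x l k * nabla_ric m x i j).
Proof.
have sG a b : smooth_on U (metric G a b) by exact: G_smooth.
have sR := smooth_on_ricci; have sRm := smooth_on_riemann.
pose A1 a b c d y := metric G a c y * ricci G b d y.
pose A2 a b c d y := metric G a d y * ricci G b c y.
have s1 a b c d : smooth_on U (A1 a b c d) by exact: smooth_onM.
have s2 a b c d : smooth_on U (A2 a b c d) by exact: smooth_onM.
rewrite /weyl_projective nabla_04B //; last first.
  move=> a b c d; apply: smooth_onM => //; first exact: smooth_on_cst.
  exact: smooth_onB (s1 a b c d) (s2 a b c d).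
rewrite (@nabla_04Z _ (fun a b c d y => A1 a b c d y - A2 a b c d y));
  last first.
  by move=> a b c d; exact: smooth_onB (s1 a b c d) (s2 a b c d).
rewrite nabla_04B // nabla_04_riemann.
rewrite (nabla_04_swap A1) !nabla_04_tensor //.
by rewrite !(nabla_metric near_sym) ?G_unit // !mul0r !add0r !nabla_02_ricci.
Qed.

(** Contracting g^ml with g_lj and g_lk leaves Kronecker deltas, so the Ricci part of P yields the
    same difference as the divergence of the curvature, scaled by 1/(n-1). *)
Lemma codifferential_weyl i j k :
  codifferential G (weyl_projective G) i j k x =
  ((n%:R - 1)^-1 - 1) * (nabla_ric j x i k - nabla_ric k x i j).
Proof.
rewrite /codifferential; set c := _^-1.
have HG a b : \sum_l invmx (G x) a l * G x l b = (a == b)%:R.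
  have /matrixP/(_ a b) := mulVmx (G_unit Ux).
  by rewrite mxE => ->; rewrite mxE.
have E m :
    \sum_l cometric G m l x * nabla_04 G (weyl_projective G) m l i j k x =
    nabla_curv m j k x m i
    - c * ((m == j)%:R * nabla_ric m x i k - (m == k)%:R * nabla_ric m x i j).
  under eq_bigr => l _ do
    rewrite nabla_04_weyl mulrBr mulrCA mulrBr !mulrA.
  rewrite sumrB -mulr_sumr sumrB -!mulr_suml !HG.
  congr (_ - _).
  have /matrixP/(_ m i) := mulKmx (G_unit Ux) (nabla_curv m j k x).
  by rewrite mxE.
under eq_bigr do rewrite E.
have D (b : 'I_n) (f : 'I_n -> R) : \sum_m (m == b)%:R * f m = f b.
  rewrite (bigD1 b) //= eqxx mul1r big1 ?addr0 // => m /negPf ->.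
  by rewrite mul0r.
rewrite sumrB (divergence_curv oU G_smooth G_sym G_unit Ux) -mulr_sumr sumrB !D.
ring.
Qed.

Lemma nabla_02_energy_momentum k i j :
  nabla_02 G (energy_momentum G) k i j x =
  nabla_ric k x i j - 2^-1 * partial k (scalar_curvature G) x * G x i j.
Proof.
have sG a b : smooth_on U (metric G a b) by exact: G_smooth.
have ss := smooth_on_scalar; have sR := smooth_on_ricci.
have s2 : smooth_on U (fun y => 2^-1 * scalar_curvature G y).
  by apply: smooth_onM => //; exact: smooth_on_cst.
rewrite -nabla_02_ricci /nabla_02 /energy_momentum.
rewrite (@partialB _ _ U) //; last exact: smooth_onM.
rewrite (@partialM _ _ U) // (@partialM _ _ U) //; last exact: smooth_on_cst.
rewrite partial_cst mul0r add0r.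
have E (f g h : 'I_n -> R) c : \sum_p f p * (g p - c * h p) =
    \sum_p f p * g p - c * \sum_p f p * h p.
  by rewrite mulr_sumr -sumrB; apply: eq_bigr => p _; ring.
rewrite !E -[G x i j]/(metric G i j x).
have := nabla_metric near_sym k i j (G_unit Ux); rewrite /nabla_02.
move: (\sum_p _ * metric G p j x) (\sum_p _ * metric G i p x) => u v.
move: (partial k (metric G i j) x) => w.
move=> /eqP; rewrite -addrA -opprD subr_eq0 => /eqP ->; ring.
Qed.

(** The equivalence holds at each point separately: only the vanishing of ds at x is needed, and
    that is algebraic in the values of nabla Ric at x. *)
Lemma Omega2_harmonic_at : (2 < n)%N ->
  (forall i j k, nabla_02 G (energy_momentum G) k i j x =
                 nabla_02 G (energy_momentum G) i k j x) <->
  (forall i j k, codifferential G (weyl_projective G) i j k x = 0).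
Proof.
move=> n2; pose s j := partial j (scalar_curvature G) x.
have := @codazzi_trace_reversal R n (G x) (invmx (G x)) s
  (fun m i j => nabla_ric m x i j) n2 (mulVmx (G_unit Ux)) (G_sym Ux)
  (nabla_ricC oU G_smooth G_sym G_unit Ux)
  (fun i => esym (partial_scalar oU G_smooth G_sym G_unit Ux i))
  (contracted_bianchi oU G_smooth G_sym G_unit Ux).
(* This factor vanishes for n = 2 only. *)
have n1 : (n%:R - 1)^-1 - 1 != 0 :> R.
  rewrite subr_eq0 -[X in _ != X]invr1 (inj_eq invr_inj) subr_eq -mulr2n.
  by rewrite eqr_nat gtn_eqF.
case=> /= codazzi reversal; split=> [Om i j k|har i j k].
- rewrite codifferential_weyl; apply/eqP.
  rewrite mulf_eq0 (negPf n1) /= subr_eq0; apply/eqP; apply: codazzi => a b c.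
  by rewrite /s -!nabla_02_energy_momentum.
- rewrite !nabla_02_energy_momentum; apply: reversal => a b c.
  have /eqP := har a b c; rewrite codifferential_weyl mulf_eq0 (negPf n1) /=.
  by rewrite subr_eq0 => /eqP.
Qed.

End PointwiseEquivalence.

Theorem theorem2 (R : realType) (M : smoothManifold R 4)
    (g : pseudoRiemannianMetric M) (hg : lorentzian g) :
  einstein_Omega2 g <-> harmonic_weyl_projective g.
Proof.
have E (a : manifold_index M) x (Ux : chart_img (manifold_chart a) x) :=
  Omega2_harmonic_at (@chart_img_open _ _ _ (manifold_chart a))
    (@metric_smooth _ _ _ g a) (@Defs.metric_sym _ _ _ g a)
    (@metric_nondegenerate _ _ _ g a) Ux isT.
by split=> h a x Ux; have [Om har] := E a x Ux; [apply: Om|apply: har];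
  exact: h.
Qed.
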